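(* Let $\mu_a,\mu_b<1$ and $\lambda_a,\lambda_b>0$, and let $a,b$ be independent real random variables with probability densities $$g_i(x)=C_i\,|x|^{-\mu_i}e^{-\lambda_i|x|},\qquad C_i=\frac{\lambda_i^{1-\mu_i}}{2\,\Gamma(1-\mu_i)}\qquad(i=a,b).$$ Let $S=2\sqrt{a^2+b^2}$ be the level spacing of the real symmetric random matrix $\begin{pmatrix} a & b\\ b & -a\end{pmatrix}$. Then $S$ has the probability density $$P(S)=C_aC_b\,S\left(\frac{S}{2}\right)^{-(\mu_a+\mu_b)}\int_0^{\pi/2}\frac{\exp\!\left(-\frac{S}{2}(\lambda_a\cos\varphi+\lambda_b\sin\varphi)\right)}{\cos^{\mu_a}\!\varphi\;\sin^{\mu_b}\!\varphi}\,d\varphi,\qquad S>0,$$ and, as $S\to0^+$, $$P(S)\sim C_aC_b\,S\left(\frac{S}{2}\right)^{-(\mu_a+\mu_b)}\frac{\Gamma\!\left(\frac{1-\mu_a}{2}\right)\Gamma\!\left(\frac{1-\mu_b}{2}\right)}{2\,\Gamma\!\left(1-\frac{\mu_a}{2}-\frac{\mu_b}{2}\right)}.$$ In particular the level repulsion exponent is $\rho=1-\mu_a-\mu_b$.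
   Context: The matrix $\begin{pmatrix} a & b\\ b & -a\end{pmatrix}$ has real eigenvalues $\pm\sqrt{a^2+b^2}$; the level spacing is the difference of the two eigenvalues. $\Gamma$ is the gamma function. The notation $f\sim h$ as $S\to0^+$ means $f(S)/h(S)\to1$. The repulsion exponent is $\rho$ if $P(S)$ is asymptotically a positive constant times $S^{\rho}$ as $S\to0^+$. *)

(* Defs.v *)
From HB Require Import structures.
From mathcomp Require Import all_boot all_order all_algebra.
From mathcomp Require Import all_classical all_reals all_analysis.

Set Implicit Arguments.
Unset Strict Implicit.
Unset Printing Implicit Defensive.

Import Order.TTheory GRing.Theory Num.Theory.
Import numFieldNormedType.Exports.

Local Open Scope classical_set_scope.
Local Open Scope ring_scope.

Section Probability.
Context (d : measure_display) (T : measurableType d) (R : realType).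
Variable P : probability T R.

Definition independent_RV (X Y : {RV P >-> R}) : Prop :=
  forall A B : set R, measurable A -> measurable B ->
    P (X @^-1` A `&` Y @^-1` B) = (P (X @^-1` A) * P (Y @^-1` B))%E.

(* Density with respect to the Lebesgue measure. [X] is a bare function, so
   that being a random variable is part of having a density. *)
Definition has_density (X : T -> R) (f : R -> R) : Prop :=
  [/\ measurable_fun [set: T] X,
      measurable_fun [set: R] f,
      forall x, 0 <= f x
    & forall A : set R, measurable A ->
        P (X @^-1` A) = (\int[lebesgue_measure]_(x in A) (f x)%:E)%E].

End Probability.

Section Asymptotics.
Variable R : realType.

Definition asymp_equiv0 (f h : R -> R) : Prop :=
  f s / h s @[s --> 0^'+] --> (1 : R).

Definition repulsion_exponent (f : R -> R) (rho : R) : Prop :=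
  exists2 c : R, 0 < c & asymp_equiv0 f (fun s => c * s `^ rho).

End Asymptotics.

Section Levels.
Variable R : realType.

Definition level_matrix (a b : R) : 'M[R]_2 :=
  \matrix_(i, j) if i != j then b else if i == 0 then a else - a.

(* The spectrum is {x, y}; since [M] has size 2, [x = y] happens exactly for a
   double eigenvalue, so multiplicities need not be recorded. *)
Definition is_level_spacing (M : 'M[R]_2) (s : R) : Prop :=
  exists x y : R, [/\ x <= y,
    forall z, eigenvalue M z = (z == x) || (z == y) & s = y - x].

End Levels.

Section Densities.
Variable R : realType.

(* Euler's integral; it converges exactly for [0 < x]. *)
Definition Gamma (x : R) : R :=
  \int[lebesgue_measure]_(t in `]0, +oo[) (t `^ (x - 1) * expR (- t)).

Definition norm_cst (mu lambda : R) : R :=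
  lambda `^ (1 - mu) / (2 * Gamma (1 - mu)).

(* The value at 0 (where [powR] is total) is irrelevant for a density. *)
Definition entry_density (mu lambda x : R) : R :=
  norm_cst mu lambda * `|x| `^ (- mu) * expR (- (lambda * `|x|)).

Definition spacing_density (mua mub la lb s : R) : R :=
  if 0 < s then
    norm_cst mua la * norm_cst mub lb * s * (s / 2) `^ (- (mua + mub)) *
    \int[lebesgue_measure]_(phi in `[0, pi / 2])
      (expR (- (s / 2 * (la * cos phi + lb * sin phi)))
       / (cos phi `^ mua * sin phi `^ mub))
  else 0.

End Densities.

(* Main.v *)
Require Import Defs.
From HB Require Import structures.
From mathcomp Require Import all_boot all_order all_algebra.
From mathcomp Require Import all_classical all_reals all_analysis.
From mathcomp Require Import measurable_realfun ring lra.

Set Implicit Arguments.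
Unset Strict Implicit.
Unset Printing Implicit Defensive.

Import Order.TTheory GRing.Theory Num.Theory.
Import numFieldNormedType.Exports.

Local Open Scope classical_set_scope.
Local Open Scope ring_scope.

(** By independence the pair (a, b) has density g_a g_b on the plane, and this
    density is even in each variable, so the law of S is four times an integral
    over the open quadrant. Polar coordinates with r = S/2 turn it into the
    density P. They are obtained without a two-dimensional change of variables:
    put y = x t, then t = tan phi, exchange the integrals by Tonelli, and put
    x = r cos phi. The same polar coordinates applied to
    x^(2 alpha - 1) y^(2 beta - 1) exp(- x^2 - y^2) evaluate the angular integral
    I of cos^(2 alpha - 1) sin^(2 beta - 1) by
    Gamma(alpha) Gamma(beta) = 2 I Gamma(alpha + beta).
    The asymptotics follow because, for S > 0, the angular integral in P(S) lies
    between exp(- S (lambda_a + lambda_b) / 2) I and I. The finiteness of the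
    Gamma values involved is a consequence of g_a and g_b having mass 1. *)

(** * Density measures and one-dimensional changes of variables *)

Section DensityMeasure.
Local Open Scope ereal_scope.
Context d (T : measurableType d) (R : realType).
Variable mu : {measure set T -> \bar R}.

(** Packs the set function as a genuine measure, so that uniqueness theorems for measures apply to
    it. *)
Lemma density_measure_exists (w : T -> R) :
  measurable_fun [set: T] w -> (forall x, 0 <= w x)%R ->
  exists nu : {measure set T -> \bar R},
    forall A, nu A = \int[mu]_(x in A) (w x)%:E.
Proof.
move=> mw w0.
pose nu0 A := \int[mu]_(x in A) (w x)%:E.
have nu00 : nu0 set0 = 0 by exact: integral_set0.
have nu0_ge0 A : 0 <= nu0 A by apply: integral_ge0 => x _; rewrite lee_fin.
have nu0_sa : semi_sigma_additive nu0.
  apply: semi_sigma_additive_nng_induced; first exact/measurable_EFinP.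
  by move=> x; rewrite lee_fin.
pose nu : {measure set T -> \bar R} :=
  HB.pack nu0 (isMeasure.Build _ _ _ nu0 nu00 nu0_ge0 nu0_sa).
by exists nu.
Qed.

Import HBNNSimple.

(** The hypothesis on [nu] is the case of indicators; linearity gives simple functions, and monotone
    convergence along [nnsfun_approx] gives every nonnegative measurable [f]. *)
Lemma ge0_integral_density_measure (nu : {measure set T -> \bar R})
    (w : T -> R) (f : T -> \bar R) :
  measurable_fun [set: T] w -> (forall x, 0 <= w x)%R ->
  (forall A, measurable A -> nu A = \int[mu]_(x in A) (w x)%:E) ->
  measurable_fun [set: T] f -> (forall x, 0 <= f x) ->
  \int[nu]_x f x = \int[mu]_x (f x * (w x)%:E).
Proof.
move=> mw w0 nuE mf f0.
have mEw : measurable_fun [set: T] (fun x => (w x)%:E) by exact/measurable_EFinP.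
pose f_ := nnsfun_approx measurableT mf.
have f_cvg x : limn (fun n => (f_ n x)%:E) = f x.
  by apply/cvg_lim => //; exact: cvg_nnsfun_approx.
have f_nd x a b : (a <= b)%N -> (f_ a x)%:E <= (f_ b x)%:E.
  by move=> ab; rewrite lee_fin; exact/lefP/nd_nnsfun_approx.
have mf_ n : measurable_fun [set: T] (fun x => (f_ n x)%:E).
  exact/measurable_EFinP.
transitivity (limn (fun n => \int[nu]_x (f_ n x)%:E)).
  rewrite -monotone_convergence//.
  - by apply: eq_integral => x _; rewrite f_cvg.
  - by move=> n x _; rewrite lee_fin.
  - by move=> x _ a b; exact: f_nd.
transitivity (limn (fun n => \int[mu]_x ((f_ n x)%:E * (w x)%:E))); last first.
  rewrite -monotone_convergence//.
  - apply: eq_integral => x _.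
    rewrite (_ : (fun n => _) = (fun n => (w x)%:E * (f_ n x)%:E)); last first.
      by apply/funext => n; rewrite muleC.
    rewrite limeMl//.
      by rewrite f_cvg muleC.
    by apply/ereal_nondecreasing_is_cvgn => a b; exact: f_nd.
  - by move=> n; exact: emeasurable_funM.
  - by move=> n x _; rewrite mule_ge0 ?lee_fin//.
  - move=> x _ a b ab.
    by apply: lee_wpmul2r; [rewrite lee_fin|exact: f_nd].
(* Only the simple function [f_ n] remains; its integral is a finite sum over its range. *)
congr (limn _); apply/funext => n.
rewrite integralT_nnsfun sintegralE.
transitivity (\int[mu]_x (\sum_(r \in range (f_ n))
    r%:E * ((\1_(f_ n @^-1` [set r]) x)%:E * (w x)%:E))); last first.
  apply: eq_integral => x _.
  rewrite [in RHS]fimfunE -fsumEFin// ge0_mule_fsuml; last first.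
    by move=> r; rewrite nnfun_muleindic_ge0.
  by apply: eq_fsbigr => r _; rewrite EFinM muleA.
rewrite ge0_integral_fsum//; last 2 first.
- move=> r; apply: emeasurable_funM => //; apply: emeasurable_funM => //.
  exact/measurable_EFinP/measurable_indic.
- move=> r x _; have [r0|r0] := leP 0%R r.
    by rewrite !mule_ge0 ?lee_fin//.
  by rewrite preimage_nnfun0// indic0 mul0e mule0.
apply: eq_fsbigr => r; rewrite inE => -[x _ <-].
have -> : nu (f_ n @^-1` [set f_ n x]) =
    \int[mu]_y ((\1_(f_ n @^-1` [set f_ n x]) y)%:E * (w y)%:E).
  rewrite nuE// [LHS]integral_mkcond; apply: eq_integral => y _.
  by rewrite patchE indicE; case: ifPn => _; rewrite ?mul1e ?mul0e.
rewrite [RHS]ge0_integralZl ?lee_fin//.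
- by apply: emeasurable_funM => //; exact/measurable_EFinP/measurable_indic.
- by move=> y _; rewrite mule_ge0 ?lee_fin//.
Qed.

End DensityMeasure.

Lemma pushforward_measure_exists d d' (T : measurableType d)
    (U : measurableType d') (R : realType) (nu : {measure set T -> \bar R})
    (F : T -> U) : measurable_fun [set: T] F ->
  exists nu' : {measure set U -> \bar R},
    nu' = pushforward nu F :> (set U -> \bar R).
Proof.
move=> mF.
by exists (measure_function_pushforward__canonical__measure_function_Measure nu mF).
Qed.

Section ChangeOfVariables.
Local Open Scope ereal_scope.
Context (R : realType).
Notation mu := (@lebesgue_measure R).

(* [F] carries the measure [w dx] on [D] to Lebesgue measure on [E]; it is
   enough to test this on the half-open intervals. *)
Lemma ge0_change_of_variables (D E : set R) (F w : R -> R) (G : R -> \bar R) :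
  measurable D -> measurable E ->
  measurable_fun [set: R] F -> measurable_fun [set: R] w ->
  (forall x, D x -> (0 <= w x)%R) ->
  (forall c d, (c < d)%R ->
    \int[mu]_(x in D `&` F @^-1` `]c, d]) (w x)%:E = mu (E `&` `]c, d])) ->
  measurable_fun [set: R] G -> (forall x, 0 <= G x) ->
  \int[mu]_(x in E) G x = \int[mu]_(x in D) (G (F x) * (w x)%:E).
Proof.
move=> mD mE mF mw w0 FE mG G0.
(* Extending both densities by zero turns the claim into an equality of two measures on the whole
   line. *)
pose wD : R -> R := w \_ D.
pose wE : R -> R := \1_E.
have mwD : measurable_fun [set: R] wD.
  by apply: (measurable_restrictT w mD).1; exact: measurable_funTS.
have mwE : measurable_fun [set: R] wE.
  exact: measurable_indic.
have wD0 x : (0 <= wD x)%R.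
  by rewrite /wD patchE; case: ifPn => // /set_mem Dx; rewrite w0.
have wE0 x : (0 <= wE x)%R by rewrite /wE indicE.
have [nuD nuDE] := density_measure_exists mu mwD wD0.
have [nuE nuEE] := density_measure_exists mu mwE wE0.
have nuEE' A : measurable A -> nuE A = mu (E `&` A).
  by move=> mA; rewrite nuEE /wE integral_indic.
have mpre A : measurable A -> measurable (F @^-1` A).
  by move=> mA; rewrite -[X in measurable X]setTI; exact: mF.
(* [F'] is [F] viewed on the type whose measurable sets are generated by the half-open intervals. *)
pose F' : measurableTypeR R -> measurableTypeR R := F.
have [nuF nuFE] := pushforward_measure_exists nuD (mF : measurable_fun setT F').
have agree (A : set (measurableTypeR R)) : measurable A ->
    nuE A = nuF A.
  move: A.
  (* Half-open intervals are stable under intersection, and the intervals []-n, n]] exhaust the line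
     with finite measure, so agreement on them suffices. *)
  apply: (@measure_unique _ R (measurableTypeR R) R.-ocitv.-measurable
    (fun n => `](- n%:R)%R, n%:R]%classic) _ _ _ _ nuE nuF) => //.
  - by move=> A B mA mB; exact: (@ocitvI R A B mA mB).
  - by move=> n; exact: is_ocitv.
  - rewrite -subTset => x _ /=.
    have [n xn] : exists n : nat, (`|x : R| < n%:R)%R.
      by exists (Num.bound `|x : R|); exact: archi_boundP.
    exists n => //=; rewrite in_itv/=; move: xn; rewrite ltr_norml.
    by move=> /andP[-> /ltW ->].
  - move=> A /ocitvP[->|[[c d] /= cd ->]]; first by rewrite !measure0.
    rewrite nuEE'//= nuFE /pushforward nuDE -FE// setIC integral_mkcondr.
    by apply: eq_integral => x _; rewrite /wD !patchE; case: ifPn.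
  - move=> n; rewrite nuEE' ?(le_lt_trans (measureIr _ _ _))//=.
    by rewrite lebesgue_measure_itv/=; case: ifP; rewrite ?ltry.
have -> : \int[mu]_(x in E) G x = \int[nuE]_x G x.
  have -> : \int[nuE]_x G x = \int[mu]_x (G x * (wE x)%:E).
    by apply: (@ge0_integral_density_measure _ (measurableTypeR R) R mu nuE
      wE G mwE wE0 _ mG G0) => A _; exact: nuEE.
  rewrite [LHS]integral_mkcond.
  apply: eq_integral => x _; rewrite /wE !patchE indicE.
  by case: ifPn; rewrite ?mule1 ?mule0.
have -> : \int[nuE]_x G x = \int[pushforward nuD F']_x G x.
  by apply: eq_measure_integral => A mA _; rewrite agree// nuFE.
rewrite ge0_integral_pushforward// preimage_setT.
have -> : \int[nuD]_x (G \o F) x = \int[mu]_x ((G \o F) x * (wD x)%:E).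
  apply: (@ge0_integral_density_measure _ (measurableTypeR R) R mu nuD
    wD (G \o F) mwD wD0 (fun A _ => nuDE A)) => /=.
    exact: (measurableT_comp mG mF).
  by move=> x /=.
rewrite [RHS]integral_mkcond; apply: eq_integral => x _; rewrite /wD !patchE/=.
by case: ifPn; rewrite ?mule0.
Qed.

End ChangeOfVariables.

(** * Substitutions by scaling, tangent, square and reflection *)

Section Substitutions.
Context (R : realType).
Notation mu := (@lebesgue_measure R).

Lemma measurable_invr : measurable_fun [set: R] (@GRing.inv R).
Proof.
(* The square makes the base of the real power nonnegative; at 0 both sides are 0. *)
rewrite (_ : GRing.inv = (fun x : R => x * (x ^+ 2) `^ (-1))).
  apply: measurable_funM => //.
  apply: (measurableT_comp (f := @powR R ^~ (-1))); first exact: measurable_powR.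
  exact: measurable_funX.
apply/funext => x; rewrite powR_inv1 ?sqr_ge0//.
by have [->|x0] := eqVneq x 0; rewrite ?invr0 ?mul0r// expr2 invfM mulrA mulfV// mul1r.
Qed.

Lemma measurable_cos : measurable_fun [set: R] (@cos R).
Proof. by apply: continuous_measurable_fun; exact: continuous_cos. Qed.

Lemma measurable_sin : measurable_fun [set: R] (@sin R).
Proof. by apply: continuous_measurable_fun; exact: continuous_sin. Qed.

Lemma measurable_tan : measurable_fun [set: R] (@tan R).
Proof.
apply: measurable_funM; first exact: measurable_sin.
by apply: measurableT_comp; [exact: measurable_invr|exact: measurable_cos].
Qed.

Lemma measurable_cosVsqr : measurable_fun [set: R] (fun x : R => cos x ^- 2).
Proof.
apply: measurableT_comp; first exact: measurable_invr.
by apply: measurable_funX; exact: measurable_cos.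
Qed.

Lemma measurable_sqrt : measurable_fun [set: R] (@Num.sqrt R).
Proof. by apply: continuous_measurable_fun; exact: sqrt_continuous. Qed.

(** Endpoints are null. This links the half-open intervals of [ge0_change_of_variables] with the
    closed ones of the fundamental theorem of calculus. *)
Lemma integral_itv_oc (f : R -> \bar R) (a b : R) :
  measurable_fun `]a, b[ f ->
  (\int[mu]_(x in `]a, b]) f x = \int[mu]_(x in `[a, b]) f x)%E.
Proof. by move=> mf; rewrite !integral_itv_bndoo. Qed.

Lemma ge0_integral_scale (c : R) (G : R -> \bar R) : 0 < c ->
  measurable_fun [set: R] G -> (forall x, (0 <= G x)%E) ->
  (\int[mu]_x G x = \int[mu]_x (G (c * x)%R * c%:E))%E.
Proof.
move=> c0 mG G0.
apply: (@ge0_change_of_variables R setT setT (fun x => c * x) (cst c)) => //.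
- exact: measurable_funM.
- by move=> x _; exact: ltW.
- move=> p q pq; rewrite !setTI.
  have -> : (fun x => c * x) @^-1` `]p, q] = `]p / c, q / c]%classic.
    apply/seteqP; split=> x /=; rewrite !in_itv/= ltr_pdivrMr// ler_pdivlMr//;
      by rewrite mulrC.
  rewrite [LHS](_ : _ = \int[mu]_(x in `](p / c)%R, (q / c)%R]) (cst c%:E x))%E//.
  rewrite integral_cst//= !lebesgue_measure_itv/= !lte_fin ltr_pM2r ?invr_gt0//.
  rewrite pq -!EFinB -EFinM; congr EFin; field; exact: lt0r_neq0.
Qed.

(** The tangent is an increasing bijection with inverse [atan] and derivative [cos x ^- 2], so the
    weight of the preimage of []c, d]] is [d - c] by the fundamental theorem of calculus. *)
Lemma ge0_integral_tan (G : R -> \bar R) :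
  measurable_fun [set: R] G -> (forall x, (0 <= G x)%E) ->
  (\int[mu]_x G x =
   \int[mu]_(x in `](- (pi / 2))%R, (pi / 2)%R[) (G (tan x) * (cos x ^- 2)%:E))%E.
Proof.
move=> mG G0.
apply: (@ge0_change_of_variables R _ setT (@tan R) (fun x => cos x ^- 2)) => //.
- exact: measurable_tan.
- exact: measurable_cosVsqr.
- by move=> x _; rewrite invr_ge0 sqr_ge0.
- move=> c d cd; rewrite setTI.
  have -> : `]- (pi / 2), pi / 2[ `&` @tan R @^-1` `]c, d] =
      `]atan c, atan d]%classic.
    apply/seteqP; split=> x /=; rewrite !in_itv/=.
      move=> [xpi /andP[cx xd]].
      have xE : x = atan (tan x) by rewrite tanK// in_itv.
      rewrite xE lt_atan//=; exact: le_atan.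
    move=> /andP[cx xd].
    have xpi : - (pi / 2) < x < pi / 2.
      by rewrite (lt_trans (atan_gtNpi2 c) cx) (le_lt_trans xd (atan_ltpi2 d)).
    split=> //; rewrite -[c]atanK -[X in _ && (_ <= X)]atanK.
    rewrite ltr_tan ?in_itv/= ?atan_gtNpi2 ?atan_ltpi2// cx/=.
    by rewrite leNgt ltr_tan ?in_itv/= ?atan_gtNpi2 ?atan_ltpi2// -leNgt.
  (* The closed interval stays strictly inside []-pi/2, pi/2[], so the weight is continuous up to
     the endpoints. *)
  have cosn0 x : x \in `[atan c, atan d] -> cos x != 0.
    rewrite in_itv/= => /andP[cx xd]; rewrite gt_eqF// cos_gt0_pihalf//.
    by rewrite (lt_le_trans (atan_gtNpi2 c) cx) (le_lt_trans xd (atan_ltpi2 d)).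
  have cosn0' x : x \in `]atan c, atan d[ -> cos x != 0.
    by move=> xcd; apply: cosn0; exact: subset_itv_oo_cc xcd.
  rewrite integral_itv_oc; last first.
    by apply/measurable_EFinP/measurable_funTS; exact: measurable_cosVsqr.
  rewrite (@continuous_FTC2 R (fun x => cos x ^- 2) (@tan R)).
  + by rewrite !atanK lebesgue_measure_itv/= lte_fin cd.
  + exact: lt_atan.
  + apply: continuous_in_subspaceT => x; rewrite inE/= => xcd.
    apply: cvgV; first by rewrite expf_neq0// cosn0.
    apply: (@continuous_comp _ _ _ (@cos R) (fun x => x ^+ 2)).
      exact: continuous_cos.
    exact: exprn_continuous.
  + split.
    * by move=> x xcd; apply: derivable_tan; exact: cosn0'.
    * apply: cvg_at_right_filter; apply: continuous_tan; apply: cosn0.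
      by rewrite in_itv/= lexx le_atan// ltW.
    * apply: cvg_at_left_filter; apply: continuous_tan; apply: cosn0.
      by rewrite in_itv/= lexx le_atan// ltW.
  + move=> x xcd; rewrite derive1E.
    by have /is_derive_tan [_ ->] := cosn0' _ xcd.
Qed.

Lemma ge0_integral_sqr (G : R -> \bar R) :
  measurable_fun [set: R] G -> (forall x, (0 <= G x)%E) ->
  (\int[mu]_(x in `]0%R, +oo[) G x =
   \int[mu]_(x in `]0%R, +oo[) (G (x ^+ 2)%R * (2 * x)%:E))%E.
Proof.
move=> mG G0.
apply: (@ge0_change_of_variables R _ _ (fun x => x ^+ 2) (fun x => 2 * x)) => //.
- exact: measurable_funM.
- by move=> x /=; rewrite in_itv/= andbT => x0; rewrite mulr_ge0// ltW.
move=> c d cd.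
(* This includes negative [y], where [Num.sqrt] is 0, so the endpoints [c] and [d] may have any
   sign. *)
have sqrtE (y x : R) : 0 < x -> (Num.sqrt y < x) = (y < x ^+ 2).
  move=> x0; rewrite -[X in _ < X]ger0_norm ?(ltW x0)// -sqrtr_sqr ltr_sqrt//.
  by rewrite exprn_gt0.
have -> : `]0, +oo[ `&` (fun x => x ^+ 2) @^-1` `]c, d] =
    `]Num.sqrt c, Num.sqrt d]%classic.
  apply/seteqP; split=> x /=; rewrite !in_itv/= andbT.
    move=> [x0 /andP[cx xd]]; rewrite sqrtE// cx/= leNgt sqrtE// -leNgt//.
  move=> /andP[cx xd]; have x0 : 0 < x by rewrite (le_lt_trans _ cx)// sqrtr_ge0.
  by rewrite x0 -sqrtE// cx/= leNgt -sqrtE// -leNgt.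
have -> : `]0, +oo[ `&` `]c, d] = `]Num.max 0 c, d]%classic.
  apply/seteqP; split=> x /=; rewrite !in_itv/= andbT gt_max.
    by move=> [-> /andP[-> ->]].
  by move=> /andP[/andP[-> ->] ->].
(* For [d <= 0] both intervals are empty: the two square roots are 0, and [Num.max 0 c] is at least
   [d]. *)
have [d0|d0] := leP d 0.
  rewrite ler0_sqrtr ?(le_trans (ltW cd))// ler0_sqrtr//.
  rewrite set_itvoc0 integral_set0 lebesgue_measure_itv/= lte_fin.
  by rewrite ltNge le_max d0.
rewrite integral_itv_oc; last first.
  by apply/measurable_EFinP/measurable_funTS; exact: measurable_funM.
have sq (y : R) : Num.sqrt y ^+ 2 = Num.max 0 y.
  have [y0|y0] := leP y 0; first by rewrite ler0_sqrtr// expr0n.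
  by rewrite sqr_sqrtr// ltW.
rewrite (@continuous_FTC2 R (fun x => 2 * x) (fun x => x ^+ 2)).
- rewrite !sq lebesgue_measure_itv/= lte_fin gt_max d0 cd.
  by rewrite /= (max_idPr (ltW d0)).
- by rewrite ltr_sqrt.
- apply: continuous_subspaceT => x.
  by apply: cvgM; [exact: cvg_cst|exact: cvg_id].
- split.
  + by move=> x _; exact: exprn_derivable.
  + by apply: cvg_at_right_filter; exact: exprn_continuous.
  + by apply: cvg_at_left_filter; exact: exprn_continuous.
- by move=> x _; rewrite exp_derive1 expr1.
Qed.

Lemma ge0_integral_even (G : R -> \bar R) :
  measurable_fun [set: R] G -> (forall x, (0 <= G x)%E) ->
  (forall x, G (- x) = G x) ->
  (\int[mu]_x G x = 2%:E * \int[mu]_(x in `]0%R, +oo[) G x)%E.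
Proof.
move=> mG G0 Geven.
rewrite -(setUv `[0%R, +oo[%classic) ge0_integral_setU//=; last 3 first.
- exact: measurableC.
- by rewrite setUv.
- exact/disj_setPCl.
rewrite mule_natl mule2n integral_itv_obnd_cbnd; last exact: measurable_funTS.
congr (_ + _)%E; rewrite setCitvr.
rewrite integral_itv_bndo_bndc; last exact: measurable_funTS.
rewrite ge0_integration_by_substitution0//.
by apply: eq_integral => x _; rewrite Geven.
Qed.

End Substitutions.

(** * Polar coordinates *)

Section Polar.
Local Open Scope ereal_scope.
Context (R : realType).
Notation mu := (@lebesgue_measure R).

(** Tonelli for the extension of [F] by zero. Asking for a sign on [A] and [B] only matters for
    integrands with a factor such as [x], nonnegative just on the half-line. *)
Lemma ge0_fubini_tonelli_in (A B : set R) (F : R -> R -> \bar R) :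
  measurable A -> measurable B ->
  measurable_fun [set: R * R] (fun z => F z.1 z.2) ->
  (forall x y, A x -> B y -> 0 <= F x y) ->
  \int[mu]_(x in A) \int[mu]_(y in B) F x y =
  \int[mu]_(y in B) \int[mu]_(x in A) F x y.
Proof.
move=> mA mB mF F0.
pose f : measurableTypeR R * measurableTypeR R -> \bar R :=
  (fun z => F z.1 z.2) \_ (A `*` B).
have mf : measurable_fun setT f.
  apply: (measurable_restrictT
    (fun z : measurableTypeR R * measurableTypeR R => F z.1 z.2) _).1.
    exact: measurableX.
  exact: measurable_funTS.
have f0 z : 0 <= f z.
  by rewrite /f patchE; case: ifPn => // /set_mem [Az Bz]; exact: F0.
have fE x y : f (x, y) = if (x \in A) && (y \in B) then F x y else 0.
  by rewrite /f patchE in_setX.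
have fAB : \int[mu]_(x in A) \int[mu]_(y in B) F x y =
    \int[mu]_x \int[mu]_y f (x, y).
  rewrite integral_mkcond; apply: eq_integral => x _; rewrite patchE.
  case: ifPn => xA.
    rewrite integral_mkcond; apply: eq_integral => y _.
    by rewrite patchE fE xA.
  by rewrite integral0_eq// => y _; rewrite fE (negbTE xA).
have fBA : \int[mu]_(y in B) \int[mu]_(x in A) F x y =
    \int[mu]_y \int[mu]_x f (x, y).
  rewrite integral_mkcond; apply: eq_integral => y _; rewrite patchE.
  case: ifPn => yB.
    rewrite integral_mkcond; apply: eq_integral => x _.
    by rewrite patchE fE yB andbT.
  by rewrite integral0_eq// => x _; rewrite fE (negbTE yB) andbF.
rewrite fAB fBA.
exact: (@fubini_tonelli _ _ (measurableTypeR R) (measurableTypeR R) R mu mu f mf f0).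
Qed.

Lemma measurable_restrict_itv (G : R -> \bar R) (i : interval R) :
  measurable_fun [set: R] G -> measurable_fun [set: R] (G \_ [set` i]).
Proof.
by move=> mG; apply: (measurable_restrictT G (measurable_itv i)).1;
  exact: measurable_funTS.
Qed.

(** Scaling by [c > 0] preserves the half-line, so the full-line version applies to [G] extended by
    zero. *)
Lemma ge0_integral_scale_oy (c : R) (G : R -> \bar R) : (0 < c)%R ->
  measurable_fun [set: R] G -> (forall x, (0 < x)%R -> 0 <= G x) ->
  \int[mu]_(x in `]0%R, +oo[) G x =
  \int[mu]_(x in `]0%R, +oo[) (G (c * x)%R * c%:E).
Proof.
move=> c0 mG G0; rewrite integral_mkcond (ge0_integral_scale c0); last 2 first.
- exact: measurable_restrict_itv.
- move=> x; rewrite patchE; case: ifPn => // /set_mem /=.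
  by rewrite in_itv/= andbT; exact: G0.
rewrite [RHS]integral_mkcond; apply: eq_integral => x _; rewrite !patchE.
rewrite !mem_setE !in_itv/= !andbT pmulr_rgt0//.
by case: ifPn; rewrite ?mul0e.
Qed.

(** On []-pi/2, pi/2[] the tangent is positive exactly where its argument is, so restricting [G] to
    the half-line halves the interval of angles. *)
Lemma ge0_integral_tan_oy (G : R -> \bar R) :
  measurable_fun [set: R] G -> (forall x, (0 < x)%R -> 0 <= G x) ->
  \int[mu]_(x in `]0%R, +oo[) G x =
  \int[mu]_(x in `]0%R, (pi / 2)%R[) (G (tan x) * (cos x ^- 2)%:E).
Proof.
move=> mG G0; rewrite integral_mkcond ge0_integral_tan; last 2 first.
- exact: measurable_restrict_itv.
- move=> x; rewrite patchE; case: ifPn => // /set_mem /=.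
  by rewrite in_itv/= andbT; exact: G0.
rewrite [LHS]integral_mkcond [RHS]integral_mkcond.
apply: eq_integral => x _; rewrite !patchE !mem_setE !in_itv/= !andbT.
have pi20 : (0 < pi / 2 :> R)%R by rewrite divr_gt0 ?pi_gt0.
have [xpi|xpi] := boolP (- (pi / 2) < x < pi / 2)%R.
  have -> : (0 < tan x)%R = (0 < x)%R.
    by rewrite -[X in (X < _)%R = _]tan0 ltr_tan// in_itv/= oppr_lt0 pi20.
  by case/andP: xpi => _ ->; rewrite andbT; case: ifPn; rewrite ?mul0e.
case: ifPn => // /andP[x0 xp]; move: xpi; rewrite xp andbT.
by rewrite (lt_trans _ x0)// oppr_lt0.
Qed.

Lemma measurable_fun_comp2 (F : R -> R -> \bar R) :
  measurable_fun [set: R * R] (fun z => F z.1 z.2) ->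
  forall (d : measure_display) (T : measurableType d) (f g : T -> R),
  measurable_fun [set: T] f -> measurable_fun [set: T] g ->
  measurable_fun [set: T] (fun t => F (f t) (g t)).
Proof.
move=> mF d T f g mf mg; apply: (measurableT_comp mF (g := fun t => (f t, g t))).
exact: measurable_fun_pair.
Qed.

Lemma ge0_integral_polar (F : R -> R -> \bar R) :
  measurable_fun [set: R * R] (fun z => F z.1 z.2) ->
  (forall x y, 0 <= F x y) ->
  \int[mu]_(x in `]0%R, +oo[) \int[mu]_(y in `]0%R, +oo[) F x y =
  \int[mu]_(r in `]0%R, +oo[) \int[mu]_(phi in `]0%R, (pi / 2)%R[)
    (F (r * cos phi)%R (r * sin phi)%R * r%:E).
Proof.
move=> mF F0.
have mFc := measurable_fun_comp2 mF.
have mE (d : measure_display) (T : measurableType d) (f : T -> R) :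
    measurable_fun setT f -> measurable_fun setT (fun t => (f t)%:E).
  by move=> mf; exact/measurable_EFinP.
(* With [x] fixed, [y = x * t] contributes the factor [x], and [t = tan phi] the factor
   [cos phi ^- 2]. *)
transitivity (\int[mu]_(x in `]0%R, +oo[) \int[mu]_(phi in `]0%R, (pi / 2)%R[)
    (F x (x * tan phi)%R * x%:E * (cos phi ^- 2)%:E)).
  apply: eq_integral => x; rewrite inE/= in_itv/= andbT => x0.
  rewrite (ge0_integral_scale_oy x0)//; last first.
    by apply: mFc => //; exact: measurable_cst.
  rewrite ge0_integral_tan_oy//.
  - apply: emeasurable_funM; last exact: measurable_cst.
    by apply: mFc; [exact: measurable_cst|exact: measurable_funM].
  - by move=> t _; rewrite mule_ge0// lee_fin ltW.
rewrite ge0_fubini_tonelli_in//; first last.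
- move=> x phi; rewrite /= !in_itv/= andbT => x0 _.
  by rewrite !mule_ge0// lee_fin ?(ltW x0)// invr_ge0 sqr_ge0.
- apply: emeasurable_funM.
    apply: emeasurable_funM; last by apply: mE; exact: measurable_fst.
    apply: mFc; first exact: measurable_fst.
    apply: measurable_funM; first exact: measurable_fst.
    by apply: measurableT_comp; [exact: measurable_tan|exact: measurable_snd].
  apply: mE.
  apply: (measurableT_comp (@measurable_cosVsqr R)); exact: measurable_snd.
(* With [phi] fixed, [x = r * cos phi] turns [x * tan phi] into [r * sin phi], and the weight
   [x * cos phi ^- 2 * cos phi] into [r]. *)
transitivity (\int[mu]_(phi in `]0%R, (pi / 2)%R[) \int[mu]_(r in `]0%R, +oo[)
    (F (r * cos phi)%R (r * sin phi)%R * r%:E)).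
  apply: eq_integral => phi; rewrite inE/= in_itv/= => /andP[p0 ppi].
  have c0 : (0 < cos phi)%R.
    apply: cos_gt0_pihalf; rewrite ppi andbT (lt_trans _ p0)// oppr_lt0.
    by rewrite divr_gt0 ?pi_gt0.
  rewrite (ge0_integral_scale_oy c0).
  - apply: eq_integral => r _.
    rewrite -!muleA -!EFinM; congr (F _ _ * _%:E).
    + by rewrite mulrC.
    + by rewrite /tan; field; exact: lt0r_neq0.
    + by field; exact: lt0r_neq0.
  - apply: emeasurable_funM; last exact: measurable_cst.
    apply: emeasurable_funM; last by apply: mE.
    by apply: mFc => //; exact: measurable_funM.
  - move=> x x0; rewrite !mule_ge0// lee_fin ?(ltW x0)//.
    by rewrite invr_ge0 sqr_ge0.
rewrite ge0_fubini_tonelli_in//.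
- apply: emeasurable_funM; last by apply: mE; exact: measurable_snd.
  have m1 := @measurable_fst _ _ (Real.sort R) (Real.sort R).
  have m2 := @measurable_snd _ _ (Real.sort R) (Real.sort R).
  apply: mFc; apply: measurable_funM => //.
    by apply: measurableT_comp => //; exact: measurable_cos.
  by apply: measurableT_comp => //; exact: measurable_sin.
- by move=> phi r _ /=; rewrite in_itv/= andbT => r0; rewrite mule_ge0// lee_fin ltW.
Qed.

End Polar.

(** * The beta integral *)

Section GammaIntegral.
Local Open Scope ereal_scope.
Context (R : realType).
Notation mu := (@lebesgue_measure R).

(** A vanishing integral would force [f = 0] almost everywhere on [D], so [D] itself would lie in a
    null set. *)
Lemma integral_gt0 (D : set R) (f : R -> R) :
  measurable D -> measurable_fun [set: R] f ->
  (forall x, D x -> (0 < f x)%R) -> mu D != 0 ->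
  0 < \int[mu]_(x in D) (f x)%:E.
Proof.
move=> mD mf f0 D0.
have i0 : 0 <= \int[mu]_(x in D) (f x)%:E.
  by apply: integral_ge0 => x Dx; rewrite lee_fin ltW// f0.
rewrite lt_neqAle i0 andbT; apply: contra_neq D0 => /esym i0'.
have [+ _] := ae_eq_integral_abs mu mD (f := EFin \o f)
  (measurable_funTS ((measurable_EFinP _ _).2 mf)).
have -> : \int[mu]_(x in D) `|(EFin \o f) x| = 0.
  rewrite -i0'; apply: eq_integral => x /set_mem Dx /=.
  by rewrite ger0_norm// ltW// f0.
move=> /(_ erefl)[N [mN N0 subN]].
apply/eqP; rewrite eq_le measure_ge0 andbT -N0 le_measure ?inE//.
move=> x Dx; apply: subN => /= /(_ Dx)/eqP.
by rewrite eqe gt_eqF// f0.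
Qed.

Lemma lebesgue_measure_oy_neq0 : mu `]0%R, +oo[%classic != 0.
Proof. by rewrite lebesgue_measure_itv/= ltry gt_eqF// addye// ltry. Qed.

Lemma pihalf_gt0 : (0 < pi / 2 :> R)%R.
Proof. by rewrite divr_gt0 ?pi_gt0. Qed.

Definition Gamma_integrand (a t : R) : R := (t `^ (a - 1) * expR (- t))%R.

(** Extended values let identities be proved before convergence is known; [Gamma] is the [fine]
    part, hence 0 if the integral diverges. *)
Definition ext_Gamma (a : R) : \bar R :=
  \int[mu]_(t in `]0%R, +oo[) (Gamma_integrand a t)%:E.

Definition trig_integrand (p q phi : R) : R := (cos phi `^ p * sin phi `^ q)%R.

(** Half of Euler's beta function at [(p + 1) / 2] and [(q + 1) / 2]. *)
Definition trig_integral (p q : R) : \bar R :=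
  \int[mu]_(phi in `]0%R, (pi / 2)%R[) (trig_integrand p q phi)%:E.

Lemma cos_sin_gt0 (phi : R) : `]0%R, (pi / 2)%R[%classic phi ->
  (0 < cos phi)%R /\ (0 < sin phi)%R.
Proof.
rewrite /= in_itv/= => /andP[p0 ppi]; split; last by apply: sin_gt0_pihalf; rewrite p0.
apply: cos_gt0_pihalf; rewrite ppi andbT (lt_trans _ p0)// oppr_lt0.
exact: pihalf_gt0.
Qed.

Lemma measurable_Gamma_integrand a : measurable_fun [set: R] (Gamma_integrand a).
Proof.
apply: measurable_funM; first exact: measurable_powR.
by apply: measurableT_comp => //; exact: measurable_expR.
Qed.

Lemma measurable_trig_integrand p q : measurable_fun [set: R] (trig_integrand p q).
Proof.
apply: measurable_funM.
  by apply: (measurableT_comp (measurable_powR p)); exact: measurable_cos.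
by apply: (measurableT_comp (measurable_powR q)); exact: measurable_sin.
Qed.

Lemma ext_Gamma_gt0 a : 0 < ext_Gamma a.
Proof.
apply: integral_gt0 => //;
  [exact: measurable_Gamma_integrand| |exact: lebesgue_measure_oy_neq0].
move=> x /=; rewrite in_itv/= andbT => x0.
by rewrite mulr_gt0 ?expR_gt0// powR_gt0.
Qed.

Lemma trig_integral_gt0 p q : 0 < trig_integral p q.
Proof.
apply: integral_gt0 => //; first exact: measurable_trig_integrand.
  by move=> x /cos_sin_gt0[c0 s0]; rewrite mulr_gt0// powR_gt0.
rewrite lebesgue_measure_itv/= lte_fin pihalf_gt0 -EFinB subr0 eqe.
by rewrite gt_eqF// pihalf_gt0.
Qed.

(** The Gamma integrand after [t = x ^+ 2]; the factor 2 comes from [dt = 2 * x * dx]. *)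
Definition gauss_power (p x : R) : R := (2 * (x `^ p * expR (- x ^+ 2)))%R.

Lemma measurable_gauss_power p : measurable_fun [set: R] (gauss_power p).
Proof.
apply: measurable_funM => //; apply: measurable_funM; first exact: measurable_powR.
apply: measurableT_comp; first exact: measurable_expR.
by apply: measurableT_comp => //; exact: measurable_funX.
Qed.

Lemma gauss_power_ge0 p x : (0 <= gauss_power p x)%R.
Proof. by rewrite mulr_ge0// mulr_ge0 ?expR_ge0 ?powR_ge0. Qed.

Lemma powR_mulr (x p : R) : (0 < x -> x `^ (p + 1) = x `^ p * x)%R.
Proof.
move=> x0; have xn0 : (x != 0)%R by exact: lt0r_neq0.
by rewrite powRD ?xn0 ?implybT// powRr1// ltW.
Qed.

Lemma Gamma_integrand_sqr (a x : R) : (0 < x ->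
  Gamma_integrand a (x ^+ 2) * (2 * x) = gauss_power (2 * a - 1) x)%R.
Proof.
move=> x0; rewrite /Gamma_integrand /gauss_power.
have -> : ((x ^+ 2) `^ (a - 1) = x `^ (2 * (a - 1)))%R.
  by rewrite powRrM powR_mulrn// ltW.
have -> : (x `^ (2 * a - 1) = x `^ (2 * (a - 1)) * x)%R.
  by rewrite -powR_mulr//; congr (_ `^ _)%R; ring.
ring.
Qed.

(** The Gaussian factors multiply to [expR (- r ^+ 2)], so radius and angle separate. Of the two
    factors 2, one stays in the radial [gauss_power] and one goes to the angle. *)
Lemma gauss_power_polar (p q r c s : R) : (0 < r -> 0 < c -> 0 < s ->
  c ^+ 2 + s ^+ 2 = 1 ->
  gauss_power p (r * c) * gauss_power q (r * s) * r =
  gauss_power (p + q + 1) r * (2 * (c `^ p * s `^ q)))%R.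
Proof.
move=> r0 c0 s0 cs; rewrite /gauss_power !powRM ?(ltW r0) ?(ltW c0) ?(ltW s0)//.
have rn0 : (r != 0)%R by exact: lt0r_neq0.
have -> : (r `^ (p + q + 1) = r `^ p * r `^ q * r)%R.
  by rewrite powR_mulr// powRD ?rn0 ?implybT.
have -> : (expR (- r ^+ 2) = expR (- (r * c) ^+ 2) * expR (- (r * s) ^+ 2))%R.
  by rewrite -expRD; congr expR; rewrite -[X in (- X)%R = _]mulr1 -cs; ring.
ring.
Qed.

Lemma ext_GammaE a :
  ext_Gamma a = \int[mu]_(x in `]0%R, +oo[) (gauss_power (2 * a - 1) x)%:E.
Proof.
rewrite /ext_Gamma ge0_integral_sqr; last 2 first.
- by apply/measurable_EFinP; exact: measurable_Gamma_integrand.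
- by move=> x; rewrite lee_fin mulr_ge0 ?expR_ge0 ?powR_ge0.
apply: eq_integral => x; rewrite inE/= in_itv/= andbT => x0.
by rewrite -EFinM Gamma_integrand_sqr.
Qed.

(** The product is a double integral over the quadrant, which polar coordinates split into a radial
    and an angular integral. The identity holds in the extended reals, whether or not the integrals
    converge. *)
Lemma ext_Gamma_mul a b :
  ext_Gamma a * ext_Gamma b =
  ext_Gamma (a + b) * (2%:E * trig_integral (2 * a - 1) (2 * b - 1)).
Proof.
set p := (2 * a - 1)%R; set q := (2 * b - 1)%R.
have mg r : measurable_fun [set: R] (fun x => (gauss_power r x)%:E).
  by apply/measurable_EFinP; exact: measurable_gauss_power.
have mt : measurable_fun [set: R] (fun x => (trig_integrand p q x)%:E).
  by apply/measurable_EFinP; exact: measurable_trig_integrand.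
have g0 r x : 0 <= (gauss_power r x)%:E by rewrite lee_fin gauss_power_ge0.
have t0 x : 0 <= (trig_integrand p q x)%:E.
  by rewrite lee_fin mulr_ge0// powR_ge0.
rewrite !ext_GammaE -/p -/q.
rewrite -[LHS]ge0_integralZr//; last 2 first.
- exact: (measurable_funTS (mg _)).
- by apply: integral_ge0 => x _.
transitivity (\int[mu]_(x in `]0%R, +oo[) \int[mu]_(y in `]0%R, +oo[)
    ((gauss_power p x)%:E * (gauss_power q y)%:E)).
  by apply: eq_integral => x _; rewrite ge0_integralZl//; exact: (measurable_funTS (mg _)).
rewrite (@ge0_integral_polar R (fun x y => (gauss_power p x)%:E * (gauss_power q y)%:E));
  last 2 first.
- apply: emeasurable_funM.
    exact: (measurableT_comp (mg p) (@measurable_fst _ _ (Real.sort R) (Real.sort R))).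
  exact: (measurableT_comp (mg q) (@measurable_snd _ _ (Real.sort R) (Real.sort R))).
- by move=> x y; rewrite mule_ge0.
rewrite -[RHS]ge0_integralZr//; last 2 first.
- exact: (measurable_funTS (mg _)).
- by rewrite mule_ge0// integral_ge0.
apply: eq_integral => r; rewrite inE/= in_itv/= andbT => r0.
rewrite muleA -ge0_integralZl//; last 2 first.
- exact: (measurable_funTS mt).
- by rewrite mule_ge0.
apply: eq_integral => phi /set_mem /cos_sin_gt0[c0 s0].
rewrite -!EFinM; congr EFin.
rewrite (gauss_power_polar _ _ r0 c0 s0 (cos2Dsin2 phi)).
have -> : (p + q + 1 = 2 * (a + b) - 1)%R by rewrite /p /q; ring.
by rewrite mulrA.
Qed.

Lemma gauss_power_le (m l x : R) :
  (gauss_power (2 * ((1 - m) / 2) - 1) x <=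
   2 * expR (l ^+ 2 / 4) * (x `^ (- m) * expR (- (l * x))))%R.
Proof.
rewrite /gauss_power.
have -> : (2 * ((1 - m) / 2) - 1 = - m :> R)%R by field.
rewrite -!mulrA ler_wpM2l// mulrCA ler_wpM2l ?powR_ge0//.
rewrite -expRD ler_expR.
(* Completing the square gives [- x ^+ 2 <= l ^+ 2 / 4 - l * x], whence the constant
   [expR (l ^+ 2 / 4)]. *)
have := sqr_ge0 (x - l / 2); nra.
Qed.

(** Comparison of integrands by [gauss_power_le]; it transfers the finite mass of an entry density
    to the Gamma value. *)
Lemma ext_Gamma_lty (m l : R) :
  \int[mu]_(x in `]0%R, +oo[) (x `^ (- m) * expR (- (l * x)))%:E < +oo ->
  ext_Gamma ((1 - m) / 2) < +oo.
Proof.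
have mf : measurable_fun [set: R] (fun x => x `^ (- m) * expR (- (l * x)))%R.
  apply: measurable_funM; first exact: measurable_powR.
  apply: measurableT_comp; first exact: measurable_expR.
  by apply: measurableT_comp => //; exact: measurable_funM.
have mE (f : R -> R) : measurable_fun [set: R] f ->
    measurable_fun [set: R] (fun x => (f x)%:E) by move=> ?; exact/measurable_EFinP.
move=> foo; rewrite ext_GammaE.
apply: (@le_lt_trans _ _ ((2 * expR (l ^+ 2 / 4))%:E *
    \int[mu]_(x in `]0%R, +oo[) (x `^ (- m) * expR (- (l * x)))%:E)); last first.
  by rewrite lte_mul_pinfty// lee_fin mulr_ge0// expR_ge0.
rewrite -ge0_integralZl//; last 2 first.
- exact: (measurable_funTS (mE _ mf)).
- by move=> x _; rewrite lee_fin mulr_ge0 ?expR_ge0 ?powR_ge0.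
apply: ge0_le_integral => //.
- by move=> x _; rewrite lee_fin gauss_power_ge0.
- exact: (measurable_funTS (mE _ (@measurable_gauss_power _))).
- apply: (measurable_funTS (mE _ (measurable_funM _ mf))); exact: measurable_cst.
- move=> x _; rewrite -EFinM lee_fin; exact: gauss_power_le.
Qed.

Lemma GammaE a : Gamma a = fine (ext_Gamma a).
Proof. by []. Qed.

Lemma Gamma_ge0 (a : R) : (0 <= Gamma a)%R.
Proof. by rewrite GammaE fine_ge0// ltW// ext_Gamma_gt0. Qed.

(** In [ext_Gamma_mul] the left side is finite and all factors are positive, so both factors on the
    right are finite and the division is legitimate. *)
Lemma beta_integral (m n : R) :
  ext_Gamma ((1 - m) / 2) < +oo -> ext_Gamma ((1 - n) / 2) < +oo ->
  trig_integral (- m) (- n) =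
  (Gamma ((1 - m) / 2) * Gamma ((1 - n) / 2) / (2 * Gamma (1 - m / 2 - n / 2)))%:E.
Proof.
move=> am an.
have := ext_Gamma_mul ((1 - m) / 2) ((1 - n) / 2).
have -> : (2 * ((1 - m) / 2) - 1 = - m :> R)%R by field.
have -> : (2 * ((1 - n) / 2) - 1 = - n :> R)%R by field.
have -> : ((1 - m) / 2 + (1 - n) / 2 = 1 - m / 2 - n / 2 :> R)%R by field.
rewrite !GammaE.
have := ext_Gamma_gt0 ((1 - m) / 2).
have := ext_Gamma_gt0 ((1 - n) / 2).
have := ext_Gamma_gt0 (1 - m / 2 - n / 2).
have := trig_integral_gt0 (- m) (- n).
move: (trig_integral _ _) (ext_Gamma (1 - m / 2 - n / 2)) am an.
case: (ext_Gamma ((1 - m) / 2)) => [x| |]//; case: (ext_Gamma ((1 - n) / 2)) => [y| |]//.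
move=> I G _ _ I0 G0 y0 x0.
(* An infinite angular integral would make a finite product infinite; [G] is treated likewise
   below. *)
case: I I0 => [i| |]// I0; last first.
  by rewrite gt0_muley// gt0_muley// -EFinM.
case: G G0 => [g| |]// G0; last first.
  by rewrite -!EFinM gt0_mulye// lte_fin mulr_gt0.
rewrite -!EFinM /= => -[xy]; congr EFin; rewrite xy.
by field; rewrite lt0r_neq0// -lte_fin.
Qed.

End GammaIntegral.

(** * Joint law and law of the spacing *)

Section JointLaw.
Local Open Scope ereal_scope.
Context (R : realType).
Notation mu := (@lebesgue_measure R).

Lemma measurable_fun_integral_in (B : set R) (F : R -> R -> \bar R) :
  measurable B -> measurable_fun [set: R * R] (fun z => F z.1 z.2) ->
  (forall x y, B y -> 0 <= F x y) ->
  measurable_fun [set: R] (fun x => \int[mu]_(y in B) F x y).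
Proof.
move=> mB mF F0.
pose f : measurableTypeR R * measurableTypeR R -> \bar R :=
  (fun z => F z.1 z.2) \_ (setT `*` B).
have mf : measurable_fun setT f.
  apply: (measurable_restrictT
    (fun z : measurableTypeR R * measurableTypeR R => F z.1 z.2) _).1.
    exact: measurableX.
  exact: measurable_funTS.
have f0 z : 0 <= f z.
  by rewrite /f patchE; case: ifPn => // /set_mem [_ Bz]; exact: F0.
have := @measurable_fun_fubini_tonelli_F _ _ (measurableTypeR R)
  (measurableTypeR R) R mu f mf f0.
rewrite (_ : fubini_F mu f = fun x => \int[mu]_(y in B) F x y)//.
apply/funext => x; rewrite /fubini_F [RHS]integral_mkcond.
by apply: eq_integral => y _; rewrite /f !patchE in_setX in_setT.
Qed.

(** Each reflection contributes a factor 2. Their product 4 is kept inside the integrand, ready for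
    [ge0_integral_polar]. *)
Lemma ge0_integral_even2 (F : R -> R -> \bar R) :
  measurable_fun [set: R * R] (fun z => F z.1 z.2) ->
  (forall x y, 0 <= F x y) ->
  (forall x y, F (- x)%R y = F x y) -> (forall x y, F x (- y)%R = F x y) ->
  \int[mu]_x \int[mu]_y F x y =
  \int[mu]_(x in `]0%R, +oo[) \int[mu]_(y in `]0%R, +oo[) (4%:E * F x y).
Proof.
move=> mF F0 Fx Fy.
have mFx x : measurable_fun [set: R] (F x).
  exact: (measurable_fun_pair2 x mF).
have mI : measurable_fun [set: R] (fun x => \int[mu]_y F x y).
  exact: measurable_fun_integral_in.
have I0 x : 0 <= \int[mu]_y F x y by exact: integral_ge0.
rewrite (ge0_integral_even mI I0); last first.
  by move=> x; apply: eq_integral => y _; rewrite Fx.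
rewrite -ge0_integralZl//; last exact: (measurable_funTS mI).
apply: eq_integral => x _.
rewrite (ge0_integral_even (mFx x) (F0 x) (Fy x)) muleA -EFinM.
rewrite -ge0_integralZl//; last exact: (measurable_funTS (mFx x)).
by apply: eq_integral => y _; congr (_%:E * _); rewrite -natrM.
Qed.

Context (d : measure_display) (T : measurableType d) (P : probability T R).

(** The law of the pair and the measure with density [f x * g y] both take product values on
    rectangles, hence both equal the product of the marginal laws. *)
Lemma joint_density (X Y : {RV P >-> R}) (f g : R -> R) :
  independent_RV X Y -> has_density P X f -> has_density P Y g ->
  forall D : set (R * R), measurable D ->
  P [set w | D (X w, Y w)] =
  \int[mu]_x \int[mu]_y (\1_D (x, y) * (f x * g y))%:E.
Proof.
move=> indXY [mX mf f0 PX] [mY mg g0 PY] D mD.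
pose w (z : measurableTypeR R * measurableTypeR R) : R := (f z.1 * g z.2)%R.
have m1 := @measurable_fst _ _ (measurableTypeR R) (measurableTypeR R).
have m2 := @measurable_snd _ _ (measurableTypeR R) (measurableTypeR R).
have mw : measurable_fun setT w.
  by apply: measurable_funM; [exact: (measurableT_comp mf m1)|exact: (measurableT_comp mg m2)].
have w0 z : (0 <= w z)%R by rewrite /w mulr_ge0.
have [nu nuE] := density_measure_exists (mu \x mu) mw w0.
pose X' : {RV P >-> measurableTypeR R} :=
  HB.pack (X : T -> measurableTypeR R)
    (isMeasurableFun.Build _ _ T (measurableTypeR R) X mX).
pose Y' : {RV P >-> measurableTypeR R} :=
  HB.pack (Y : T -> measurableTypeR R)
    (isMeasurableFun.Build _ _ T (measurableTypeR R) Y mY).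
pose XY t : measurableTypeR R * measurableTypeR R := (X t, Y t).
have mXY : measurable_fun setT XY by exact: measurable_fun_pair.
have [Q QE] := pushforward_measure_exists P mXY.
have nuT (E : set (measurableTypeR R * measurableTypeR R)) : measurable E ->
    nu E = \int[mu]_x \int[mu]_y (\1_E (x, y) * (f x * g y))%:E.
  move=> mE; rewrite nuE integral_mkcond.
  rewrite (_ : _ \_ E = (fun z => (\1_E z * w z)%:E)); last first.
    apply/funext => z; rewrite patchE indicE.
    by case: ifPn; rewrite ?mul1r ?mul0r.
  rewrite fubini_tonelli1//.
  - by apply/measurable_EFinP; apply: measurable_funM => //; exact: measurable_indic.
  - by move=> z; rewrite lee_fin mulr_ge0.
(* On rectangles, this is exactly independence. *)
have rectQ A B : measurable A -> measurable B ->
    Q (A `*` B) = distribution P X' A * distribution P Y' B.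
  by move=> mA mB; rewrite QE /pushforward -indXY.
have mEf : measurable_fun [set: R] (fun x => (f x)%:E) by exact/measurable_EFinP.
have mEg : measurable_fun [set: R] (fun x => (g x)%:E) by exact/measurable_EFinP.
have rectnu A B : measurable A -> measurable B ->
    nu (A `*` B) = distribution P X' A * distribution P Y' B.
  move=> mA mB; rewrite nuT; last exact: measurableX.
  rewrite /distribution /pushforward PX// PY//.
  rewrite -ge0_integralZr//; last 3 first.
  - exact: (measurable_funTS mEf).
  - by move=> x _; rewrite lee_fin.
  - by apply: integral_ge0 => x _; rewrite lee_fin.
  rewrite [RHS]integral_mkcond; apply: eq_integral => x _; rewrite patchE.
  rewrite -ge0_integralZl//; last 3 first.
  - exact: (measurable_funTS mEg).
  - by move=> y _; rewrite lee_fin.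
  - by rewrite lee_fin.
  case: ifPn => xA; last first.
    rewrite integral0_eq// => y _.
    by rewrite indicE in_setX (negbTE xA) mul0r.
  rewrite [RHS]integral_mkcond; apply: eq_integral => y _.
  rewrite patchE indicE in_setX xA/=.
  by case: ifPn; rewrite ?mul1r ?mul0r// EFinM.
rewrite -nuT//.
transitivity (Q D); first by rewrite QE.
exact: etrans (esym (product_measure_unique rectQ mD)) (product_measure_unique rectnu mD).
Qed.

(** After reduction to the quadrant and polar coordinates, the spacing is [2 * r], a function of the
    radius alone. *)
Lemma spacing_law (X Y : {RV P >-> R}) (f g : R -> R) :
  independent_RV X Y -> has_density P X f -> has_density P Y g ->
  (forall x, f (- x)%R = f x) -> (forall y, g (- y)%R = g y) ->
  forall A : set R, measurable A ->
  P [set w | A (2 * Num.sqrt (X w ^+ 2 + Y w ^+ 2))%R] =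
  \int[mu]_(s in `]0%R, +oo[) \int[mu]_(phi in `]0%R, (pi / 2)%R[)
    (\1_A s * (s * (f (s / 2 * cos phi) * g (s / 2 * sin phi))))%:E.
Proof.
move=> indXY Xf Yg feven geven A mA.
have [_ mf f0 _] := Xf; have [_ mg g0 _] := Yg.
pose h (x y : R) : R := (2 * Num.sqrt (x ^+ 2 + y ^+ 2))%R.
have m1 := @measurable_fst _ _ (Real.sort R) (Real.sort R).
have m2 := @measurable_snd _ _ (Real.sort R) (Real.sort R).
have mh : measurable_fun [set: R * R] (fun z => h z.1 z.2).
  apply: measurable_funM => //.
  apply: (measurableT_comp (@measurable_sqrt R)).
  by apply: measurable_funD; apply: measurable_funX.
pose D : set (R * R) := [set z | A (h z.1 z.2)].
have mD : measurable D by rewrite -[D]setTI; exact: mh.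
rewrite (_ : [set w | _] = [set w | D (X w, Y w)])//.
rewrite (joint_density indXY Xf Yg mD).
pose F (x y : R) : \bar R := (\1_A (h x y) * (f x * g y))%:E.
have mF : measurable_fun [set: R * R] (fun z => F z.1 z.2).
  apply/measurable_EFinP; apply: measurable_funM.
    have mi : measurable_fun [set: R] (\1_A : R -> R) by exact: measurable_indic.
    exact: (measurableT_comp mi mh).
  by apply: measurable_funM; [exact: (measurableT_comp mf m1)|exact: (measurableT_comp mg m2)].
have F0 x y : 0 <= F x y by rewrite lee_fin !mulr_ge0.
transitivity (\int[mu]_x \int[mu]_y F x y).
  by apply: eq_integral => x _; apply: eq_integral.
rewrite ge0_integral_even2//; last 2 first.
- by move=> x y; rewrite /F /h sqrrN feven.
- by move=> x y; rewrite /F /h sqrrN geven.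
rewrite (@ge0_integral_polar R (fun x y => 4%:E * F x y)); last 2 first.
- by apply: emeasurable_funM => //; exact: measurable_cst.
- by move=> x y; rewrite mule_ge0.
(* The absolute value makes [H] nonnegative for every [r] and changes nothing on the half-line. *)
pose H (r phi : R) := 4%:E * F (r * cos phi)%R (r * sin phi)%R * `|r|%:E.
have mH : measurable_fun [set: R * R] (fun z => H z.1 z.2).
  apply: emeasurable_funM; last first.
    by apply/measurable_EFinP; exact: measurableT_comp.
  apply: emeasurable_funM; first exact: measurable_cst.
  apply: (measurable_fun_comp2 mF); apply: measurable_funM => //.
    exact: (measurableT_comp (@measurable_cos R) m2).
  exact: (measurableT_comp (@measurable_sin R) m2).
have H0 r phi : 0 <= H r phi by rewrite !mule_ge0// lee_fin.
transitivity (\int[mu]_(r in `]0%R, +oo[) \int[mu]_(phi in `]0%R, (pi / 2)%R[) H r phi).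
  apply: eq_integral => r; rewrite inE/= in_itv/= andbT => r0.
  by apply: eq_integral => phi _; rewrite /H gtr0_norm.
have half0 : (0 < 2^-1 :> R)%R by rewrite invr_gt0.
(* Here [r = s / 2], and [4 * r * dr] becomes [4 * (s / 2) * (1 / 2) * ds = s * ds]. *)
rewrite (ge0_integral_scale_oy half0); last 2 first.
- exact: measurable_fun_integral_in.
- by move=> r _; exact: integral_ge0.
apply: eq_integral => s; rewrite inE/= in_itv/= andbT => s0.
rewrite -ge0_integralZr//; last first.
  exact: (measurable_funTS (measurable_fun_pair2 (2^-1 * s)%R mH)).
apply: eq_integral => phi _; rewrite /H /F -!EFinM; congr EFin.
have -> : h (2^-1 * s * cos phi)%R (2^-1 * s * sin phi)%R = s.
  rewrite /h !exprMn -mulrDr cos2Dsin2 mulr1 -exprMn sqrtr_sqr ger0_norm.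
    by field.
  by rewrite mulr_ge0 ?(ltW s0) ?(ltW half0).
by rewrite gtr0_norm ?mulr_gt0// [(s / 2)%R]mulrC; field.
Qed.

End JointLaw.

(** * The spacing density *)

Section SpacingDensity.
Context (R : realType).
Notation mu := (@lebesgue_measure R).

Lemma entry_density_even (m l x : R) : entry_density m l (- x) = entry_density m l x.
Proof. by rewrite /entry_density normrN. Qed.

Lemma norm_cst_ge0 (m l : R) : 0 <= norm_cst m l.
Proof. by rewrite divr_ge0 ?powR_ge0// mulr_ge0// Gamma_ge0. Qed.

Lemma measurable_power_exp (m l : R) :
  measurable_fun [set: R] (fun x : R => x `^ (- m) * expR (- (l * x))).
Proof.
apply: measurable_funM; first exact: measurable_powR.
apply: measurableT_comp; first exact: measurable_expR.
by apply: measurableT_comp => //; exact: measurable_funM.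
Qed.

(* Total mass 1 makes both factors of [norm_cst * integral] positive and finite. *)
Lemma entry_density_mass d (T : measurableType d) (P : probability T R)
    (X : T -> R) (m l : R) : has_density P X (entry_density m l) ->
  0 < norm_cst m l /\
  (\int[mu]_(x in `]0%R, +oo[) (x `^ (- m) * expR (- (l * x)))%:E < +oo)%E.
Proof.
move=> [_ mf f0 PX].
have mEf : measurable_fun [set: R] (fun x => (entry_density m l x)%:E).
  exact/measurable_EFinP.
have mEp : measurable_fun [set: R] (fun x => (x `^ (- m) * expR (- (l * x)))%:E).
  by apply/measurable_EFinP; exact: measurable_power_exp.
have := PX setT measurableT.
rewrite preimage_setT probability_setT ge0_integral_even//; last first.
  by move=> x; rewrite entry_density_even.
have -> : (\int[mu]_(x in `]0%R, +oo[) (entry_density m l x)%:E =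
    (norm_cst m l)%:E *
    \int[mu]_(x in `]0%R, +oo[) (x `^ (- m) * expR (- (l * x)))%:E)%E.
  rewrite -ge0_integralZl//; last 3 first.
  - exact: (measurable_funTS mEp).
  - by move=> x _; rewrite lee_fin mulr_ge0 ?expR_ge0 ?powR_ge0.
  - by rewrite lee_fin norm_cst_ge0.
  apply: eq_integral => x; rewrite inE/= in_itv/= andbT => x0.
  by rewrite /entry_density gtr0_norm// -EFinM mulrA.
have := norm_cst_ge0 m l.
(* A divergent Euler integral would make [norm_cst] equal to 0 through the conventions for [fine]
   and division; the mass would then be 0, not 1. *)
rewrite le_eqVlt => /predU1P[<-|C0].
  by rewrite mul0e mule0 => /eqP; rewrite eqe oner_eq0.
move=> mass1; split=> //; rewrite ltNge leye_eq; apply/negP => /eqP Koo.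
by move: mass1; rewrite Koo gt0_muley ?lte_fin// gt0_muley ?lte_fin.
Qed.

Context (mua mub la lb : R).

Definition angular_integrand (s phi : R) : R :=
  expR (- (s / 2 * (la * cos phi + lb * sin phi))) /
    (cos phi `^ mua * sin phi `^ mub).

Definition angular_integral (s : R) : \bar R :=
  (\int[mu]_(phi in `]0%R, (pi / 2)%R[) (angular_integrand s phi)%:E)%E.

Definition spacing_prefactor (s : R) : R :=
  norm_cst mua la * norm_cst mub lb * s * (s / 2) `^ (- (mua + mub)).

Lemma spacing_prefactor_ge0 s : 0 < s -> 0 <= spacing_prefactor s.
Proof.
move=> s0; rewrite /spacing_prefactor mulr_ge0 ?powR_ge0// mulr_ge0 ?(ltW s0)//.
by rewrite mulr_ge0 ?norm_cst_ge0.
Qed.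

Lemma angular_integrandE s phi : angular_integrand s phi =
  expR (- (s / 2 * (la * cos phi + lb * sin phi))) *
    trig_integrand (- mua) (- mub) phi.
Proof. by rewrite /angular_integrand /trig_integrand !powRN -invfM. Qed.

Lemma angular_integrand_ge0 s phi : 0 <= angular_integrand s phi.
Proof. by rewrite divr_ge0 ?expR_ge0// mulr_ge0 ?powR_ge0. Qed.

Lemma measurable_angular_integrand :
  measurable_fun [set: R * R] (fun z => angular_integrand z.1 z.2).
Proof.
have m1 := @measurable_fst _ _ (Real.sort R) (Real.sort R).
have m2 := @measurable_snd _ _ (Real.sort R) (Real.sort R).
have mc := measurableT_comp (@measurable_cos R) m2.
have ms := measurableT_comp (@measurable_sin R) m2.
apply: measurable_funM.
  apply: measurableT_comp; first exact: measurable_expR.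
  apply: measurableT_comp => //; apply: measurable_funM.
    exact: measurable_funM.
  by apply: measurable_funD; apply: measurable_funM.
apply: (measurableT_comp (@measurable_invr R)); apply: measurable_funM.
  exact: (measurableT_comp (@measurable_powR R mua) mc).
exact: (measurableT_comp (@measurable_powR R mub) ms).
Qed.

Lemma measurable_angular_integrand2 s :
  measurable_fun [set: R] (fun phi => (angular_integrand s phi)%:E).
Proof.
by apply/measurable_EFinP; exact: (measurable_fun_pair2 s measurable_angular_integrand).
Qed.

Lemma measurable_angular_integral : measurable_fun [set: R] angular_integral.
Proof.
apply: (@measurable_fun_integral_in R _ (fun s phi => (angular_integrand s phi)%:E)) => //.
  by apply/measurable_EFinP; exact: measurable_angular_integrand.
by move=> s phi _; rewrite lee_fin angular_integrand_ge0.
Qed.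

(** Dropping the null endpoints leaves the open interval, where cosine and sine are positive. *)
Lemma spacing_densityE s : spacing_density mua mub la lb s =
  if 0 < s then spacing_prefactor s * fine (angular_integral s) else 0.
Proof.
rewrite /spacing_density; case: ifPn => // _; congr (_ * _).
rewrite /Rintegral integral_itv_bndoo//.
exact: (measurable_funTS (measurable_angular_integrand2 s)).
Qed.

Lemma measurable_spacing_density :
  measurable_fun [set: R] (spacing_density mua mub la lb).
Proof.
rewrite (_ : spacing_density _ _ _ _ = fun s =>
  if 0 < s then spacing_prefactor s * fine (angular_integral s) else 0); last first.
  by apply/funext => s; rewrite spacing_densityE.
apply: measurable_fun_ifT.
- exact: measurable_fun_ltr.
- apply: measurable_funM.
    apply: measurable_funM; first exact: measurable_funM.
    apply: (measurableT_comp (@measurable_powR R _)); exact: measurable_funM.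
  apply: (measurableT_comp (f := fine)); first exact: fine_measurable.
  exact: measurable_angular_integral.
- exact: measurable_cst.
Qed.

Lemma spacing_density_ge0 s : 0 <= spacing_density mua mub la lb s.
Proof.
rewrite spacing_densityE; case: ifPn => // s0.
rewrite mulr_ge0//.
  by rewrite spacing_prefactor_ge0.
by apply: fine_ge0; apply: integral_ge0 => phi _; rewrite lee_fin angular_integrand_ge0.
Qed.

Lemma entry_density_polar (s c t : R) : 0 < s -> 0 < c -> 0 < t ->
  s * (entry_density mua la (s / 2 * c) * entry_density mub lb (s / 2 * t)) =
  spacing_prefactor s *
    (expR (- (s / 2 * (la * c + lb * t))) / (c `^ mua * t `^ mub)).
Proof.
move=> s0 c0 t0; have s20 : 0 < s / 2 by rewrite divr_gt0.
have s2n0 : s / 2 != 0 by exact: lt0r_neq0.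
rewrite /entry_density /spacing_prefactor.
(* Treating [s / 2] as an atom [u] lets its powers be collected into the prefactor. *)
move: (s / 2) s20 s2n0 => u u0 un0; rewrite !gtr0_norm ?mulr_gt0//.
rewrite !powRM ?(ltW u0) ?(ltW c0) ?(ltW t0)//.
rewrite (opprD mua mub) powRD ?un0 ?implybT// !powRN invfM.
have -> : expR (- (u * (la * c + lb * t))) =
    expR (- (la * (u * c))) * expR (- (lb * (u * t))).
  by rewrite -expRD; congr expR; ring.
ring.
Qed.

Context (hla : 0 < la) (hlb : 0 < lb) (B : R).
Hypothesis trigB : trig_integral (- mua) (- mub) = B%:E.

(** On the open quadrant the exponent is nonpositive, so the exponential is at most 1. *)
Lemma angular_integral_le s : 0 < s -> (angular_integral s <= B%:E)%E.
Proof.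
move=> s0; rewrite -trigB; apply: ge0_le_integral => //.
- by move=> phi _; rewrite lee_fin angular_integrand_ge0.
- exact: (measurable_funTS (measurable_angular_integrand2 s)).
- apply: measurable_funTS; apply/measurable_EFinP; exact: measurable_trig_integrand.
move=> phi /cos_sin_gt0[c0 t0]; rewrite lee_fin angular_integrandE ler_piMl//.
  by rewrite mulr_ge0 ?powR_ge0.
rewrite -expR0 ler_expR oppr_le0 mulr_ge0//; first by rewrite divr_ge0// ltW.
by rewrite addr_ge0 ?mulr_ge0 ?(ltW hla) ?(ltW hlb) ?(ltW c0) ?(ltW t0).
Qed.

(** Replacing cosine and sine by their upper bound 1 in the exponent gives a lower bound independent
    of the angle. *)
Lemma angular_integral_ge s : 0 < s ->
  ((expR (- (s / 2 * (la + lb))) * B)%:E <= angular_integral s)%E.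
Proof.
have mt : measurable_fun [set: R] (fun phi => (trig_integrand (- mua) (- mub) phi)%:E).
  by apply/measurable_EFinP; exact: measurable_trig_integrand.
have t0 phi : 0 <= trig_integrand (- mua) (- mub) phi.
  by rewrite mulr_ge0 ?powR_ge0.
move=> s0; rewrite EFinM -trigB -ge0_integralZl//; last 2 first.
- exact: (measurable_funTS mt).
- by move=> phi _; rewrite lee_fin.
apply: ge0_le_integral => //.
- by move=> phi _; rewrite -EFinM lee_fin mulr_ge0 ?expR_ge0.
- by apply: emeasurable_funM; [exact: measurable_cst|exact: (measurable_funTS mt)].
- exact: (measurable_funTS (measurable_angular_integrand2 s)).
move=> phi _; rewrite -EFinM lee_fin angular_integrandE ler_wpM2r//.
rewrite ler_expR lerN2 ler_wpM2l//; first by rewrite divr_ge0// ltW.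
by apply: lerD; apply: ler_piMr; rewrite ?cos_le1 ?sin_le1//; exact: ltW.
Qed.

Lemma angular_integral_fin s : 0 < s -> angular_integral s \is a fin_num.
Proof.
move=> s0; rewrite ge0_fin_numE.
  by rewrite (le_lt_trans (angular_integral_le s0))// ltry.
by apply: integral_ge0 => phi _; rewrite lee_fin angular_integrand_ge0.
Qed.

(** For [s > 0] the prefactor leaves the inner integral, and finiteness of [angular_integral s]
    ensures that [fine] in the density loses nothing. For [s <= 0] both integrands vanish. *)
Lemma spacing_density_integral (A : set R) : measurable A ->
  (\int[mu]_(s in `]0%R, +oo[) \int[mu]_(phi in `]0%R, (pi / 2)%R[)
    (\1_A s * (s * (entry_density mua la (s / 2 * cos phi) *
                    entry_density mub lb (s / 2 * sin phi))))%:E =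
  \int[mu]_(s in A) (spacing_density mua mub la lb s)%:E)%E.
Proof.
move=> mA; rewrite [LHS]integral_mkcond [RHS]integral_mkcond.
apply: eq_integral => s _; rewrite !patchE spacing_densityE mem_setE in_itv/= andbT.
case: ifPn => [s0|]; last by case: ifPn.
transitivity (((\1_A s * spacing_prefactor s)%R)%:E * angular_integral s)%E.
  rewrite -ge0_integralZl//; last 3 first.
  - exact: (measurable_funTS (measurable_angular_integrand2 s)).
  - by move=> phi _; rewrite lee_fin angular_integrand_ge0.
  - by rewrite lee_fin mulr_ge0 ?spacing_prefactor_ge0.
  apply: eq_integral => phi /set_mem /cos_sin_gt0[c0 t0].
  by rewrite -EFinM entry_density_polar//; congr EFin; exact: mulrA.
rewrite -[X in (_ * X)%E](fineK (angular_integral_fin s0)) -EFinM indicE.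
by case: ifPn; rewrite ?mul1r ?mul0r.
Qed.

Lemma spacing_prefactor_neq0 s : 0 < norm_cst mua la -> 0 < norm_cst mub lb ->
  0 < s -> spacing_prefactor s != 0.
Proof.
move=> ca cb s0; rewrite lt0r_neq0// /spacing_prefactor.
by rewrite mulr_gt0 ?powR_gt0 ?divr_gt0// mulr_gt0// mulr_gt0.
Qed.

Lemma spacing_density_equiv : 0 < B ->
  0 < norm_cst mua la -> 0 < norm_cst mub lb ->
  asymp_equiv0 (spacing_density mua mub la lb)
    (fun s => spacing_prefactor s * B).
Proof.
move=> B0 ca cb; rewrite /asymp_equiv0.
(* The prefactor cancels in the ratio, leaving [angular_integral s] over [B], which the two bounds
   squeeze to 1. *)
apply: (@squeeze_cvgr _ _ _ _ (fun s => expR (- (s / 2 * (la + lb)))) (cst 1)).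
- near=> s.
  have s0 : 0 < s by near: s; exact: nbhs_right_gt.
  rewrite spacing_densityE s0 -mulf_div divff ?mul1r; last first.
    exact: spacing_prefactor_neq0.
  have Jfin := angular_integral_fin s0.
  rewrite ler_pdivlMr// ler_pdivrMr// mul1r -!lee_fin fineK//.
  by rewrite angular_integral_ge// angular_integral_le.
- have limE : (fun s : R => expR (- (s / 2 * (la + lb)))) 0 = 1.
    by rewrite !mul0r oppr0 expR0.
  rewrite -[X in _ --> X]limE.
  apply: cvg_at_right_filter.
  apply: (@continuous_comp _ _ _ (fun s : R => - (s / 2 * (la + lb))) expR).
    apply: cvgN; apply: cvgM; last exact: cvg_cst.
    by apply: cvgM; [exact: cvg_id|exact: cvg_cst].
  exact: continuous_expR.
- exact: cvg_cst.
Unshelve. all: by end_near. Qed.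

Lemma spacing_repulsion : 0 < B ->
  0 < norm_cst mua la -> 0 < norm_cst mub lb ->
  repulsion_exponent (spacing_density mua mub la lb) (1 - mua - mub).
Proof.
move=> B0 ca cb.
(* The power of [2^-1] is split off from that of [s / 2]; the remaining power of [s], times the
   factor [s], has exponent [1 - mua - mub]. *)
exists (norm_cst mua la * norm_cst mub lb * (2^-1) `^ (- (mua + mub)) * B).
  by rewrite mulr_gt0// mulr_gt0 ?powR_gt0 ?invr_gt0// mulr_gt0.
have := spacing_density_equiv B0 ca cb; rewrite /asymp_equiv0.
apply: cvg_trans; apply: near_eq_cvg; near=> s.
have s0 : 0 < s by near: s; exact: nbhs_right_gt.
congr (_ / _); rewrite /spacing_prefactor powRM ?(ltW s0) ?invr_ge0//.
have -> : 1 - mua - mub = - (mua + mub) + 1 by ring.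
by rewrite powR_mulr//; ring.
Unshelve. all: by end_near. Qed.

End SpacingDensity.

(** * Eigenvalues of the level matrix *)

Section LevelMatrix.
Context (R : realType).

(** The characteristic polynomial is [('X - a) * ('X + a) - b ^+ 2], by expansion along the first
    row. *)
Lemma level_matrix_eigenvalue (a b z : R) :
  eigenvalue (level_matrix a b) z = (z ^+ 2 == a ^+ 2 + b ^+ 2).
Proof.
rewrite eigenvalue_root_char rootE /char_poly.
rewrite (_ : \det (char_poly_mx _) = ('X - a%:P) * ('X + a%:P) - b%:P ^+ 2); last first.
  rewrite (expand_det_row _ ord0) !big_ord_recl big_ord0 addr0.
  rewrite /cofactor !det_mx11 !mxE/= ?mulr0n ?mulr1n ?sub0r.
  have -> : (0 + bump 0 0 = 1)%N by [].
  rewrite polyCN; ring.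
by rewrite !hornerE/= -[RHS]subr_eq0; congr (_ == _); ring.
Qed.

Lemma level_matrix_spacing (a b : R) :
  is_level_spacing (level_matrix a b) (2 * Num.sqrt (a ^+ 2 + b ^+ 2)).
Proof.
set r := Num.sqrt _; have r0 : 0 <= r by exact: sqrtr_ge0.
exists (- r), r; split.
- by rewrite (le_trans _ r0)// oppr_le0.
- move=> z; rewrite level_matrix_eigenvalue.
  have -> : a ^+ 2 + b ^+ 2 = r ^+ 2 by rewrite sqr_sqrtr// addr_ge0 ?sqr_ge0.
  by rewrite eqf_sqr orbC.
- by rewrite opprK mulr_natl mulr2n.
Qed.

End LevelMatrix.

Theorem mainTheorem5 (R : realType) (d : measure_display)
    (T : measurableType d) (P : probability T R)
    (mua mub la lb : R) (a b : {RV P >-> R})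
    (hmua : mua < 1) (hmub : mub < 1) (hla : 0 < la) (hlb : 0 < lb)
    (hab : independent_RV a b)
    (ha : has_density P a (entry_density mua la))
    (hb : has_density P b (entry_density mub lb)) :
  let S : T -> R := fun w => 2 * Num.sqrt (a w ^+ 2 + b w ^+ 2) in
  let PS : R -> R := spacing_density mua mub la lb in
  [/\ forall w, is_level_spacing (level_matrix (a w) (b w)) (S w),
      has_density P S PS,
      asymp_equiv0 PS (fun s =>
        norm_cst mua la * norm_cst mub lb * s * (s / 2) `^ (- (mua + mub)) *
        (Gamma ((1 - mua) / 2) * Gamma ((1 - mub) / 2)
         / (2 * Gamma (1 - mua / 2 - mub / 2))))
    & repulsion_exponent PS (1 - mua - mub)].
Proof.
move=> S PS.
(* Unit mass gives both a positive normalising constant and a finite Gamma value. *)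
have [ca /ext_Gamma_lty Ga_lty] := entry_density_mass ha.
have [cb /ext_Gamma_lty Gb_lty] := entry_density_mass hb.
have trigB := beta_integral Ga_lty Gb_lty.
(* Positivity of the quotient of Gamma values is read off from the integral that it evaluates. *)
have := trig_integral_gt0 (- mua) (- mub); rewrite trigB lte_fin => B0.
split.
- by move=> w; exact: level_matrix_spacing.
- split.
  + have [ma _ _ _] := ha; have [mb _ _ _] := hb.
    apply: measurable_funM => //; apply: (measurableT_comp (@measurable_sqrt R)).
    by apply: measurable_funD; apply: measurable_funX.
  + exact: measurable_spacing_density.
  + by move=> x; exact: spacing_density_ge0.
  + move=> A mA; rewrite -(spacing_density_integral hla hlb trigB mA).
    by apply: (spacing_law hab ha hb) => // x; rewrite entry_density_even.
- exact: (spacing_density_equiv hla hlb trigB B0 ca cb).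
- exact: (spacing_repulsion hla hlb trigB B0 ca cb).
Qed.
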